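(* There is no totally umbilic surface and no totally geodesic surface in $\mathbb{S}^3$ that is given as a translation surface.
   Context: $\mathbb{S}^3\subset\mathbb{R}^4$ is the unit sphere with the induced metric, identified with the group of unit quaternions (product ''$\cdot$''). A translation surface in $\mathbb{S}^3$ is a regular surface that can be locally parametrized as $X(s,t)=\alpha(s)\cdot\beta(t)$, the quaternionic product of two smooth curves $\alpha,\beta$ in $\mathbb{S}^3$ (parametrized by arc length). *)

(* Defs.v *)
From HB Require Import structures.
From mathcomp Require Import all_boot all_order all_algebra.
From mathcomp Require Import all_classical all_reals all_analysis.

Set Implicit Arguments.
Unset Strict Implicit.
Unset Printing Implicit Defensive.

Import Order.TTheory GRing.Theory Num.Theory.
Import numFieldNormedType.Exports.

Local Open Scope classical_set_scope.
Local Open Scope ring_scope.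

(* [Ck k U f] is meant for open U: f is of class C^k on U.  In finite dimension,
   f is C^(k+1) iff it is differentiable and all its directional derivatives
   are C^k. *)
Fixpoint Ck (R : realType) (V W : normedModType R) (k : nat) (U : set V)
    (f : V -> W) : Prop :=
  if k is k'.+1 then
    (forall x, U x -> differentiable f x) /\
    (forall v : V, Ck k' U (fun x => 'D_v f x))
  else forall x, U x -> {for x, continuous f}.

Definition smooth_on (R : realType) (V W : normedModType R) (U : set V)
    (f : V -> W) : Prop :=
  forall k, Ck k U f.

(* The Euclidean inner product; the library norm on ['rV[R]_4] is the sup norm,
   which is used only for the topology and for derivatives. *)
Definition dot (R : realType) (n : nat) (x y : 'rV[R]_n) : R :=
  \sum_(i < n) x 0 i * y 0 i.

Definition sphere3 (R : realType) : set 'rV[R]_4 := [set x | dot x x = 1].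

(* The row (x0, x1, x2, x3) stands for x0 + x1 i + x2 j + x3 k. *)
Definition qmul (R : realType) (x y : 'rV[R]_4) : 'rV[R]_4 :=
  let x0 := x 0 0 in let x1 := x 0 1 in let x2 := x 0 2 in let x3 := x 0 3 in
  let y0 := y 0 0 in let y1 := y 0 1 in let y2 := y 0 2 in let y3 := y 0 3 in
  \row_(i < 4) [:: x0 * y0 - x1 * y1 - x2 * y2 - x3 * y3;
                   x0 * y1 + x1 * y0 + x2 * y3 - x3 * y2;
                   x0 * y2 - x1 * y3 + x2 * y0 + x3 * y1;
                   x0 * y3 + x1 * y2 - x2 * y1 + x3 * y0]`_i.

(* X restricted to the open set U is a regular parametrization of an open piece
   of M around p: smooth, immersive, and a homeomorphism from U onto a relatively
   open subset of M.  The values of X outside U are irrelevant. *)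
Definition local_parametrization (R : realType) (M : set 'rV[R]_4)
    (p : 'rV[R]_4) (U : set (R * R)) (X : R * R -> 'rV[R]_4) : Prop :=
  [/\ open U,
      smooth_on U X,
      (forall u, U u -> injective ('d X u)) &
      exists (V : set 'rV[R]_4) (Y : 'rV[R]_4 -> R * R),
        [/\ open_nbhs p V,
            X @` U = M `&` V,
            (forall u, U u -> Y (X u) = u) &
            {within M `&` V, continuous Y}]].

Definition regular_surface_in_S3 (R : realType) (M : set 'rV[R]_4) : Prop :=
  M `<=` @sphere3 R /\
  forall p, M p -> exists U X, local_parametrization M p U X.

Definition arclength_curve_in_S3 (R : realType) (I : set R)
    (alpha : R -> 'rV[R]_4) : Prop :=
  [/\ open I, is_interval I, smooth_on I alpha &
      forall s, I s ->
        @sphere3 R (alpha s) /\ dot (derive1 alpha s) (derive1 alpha s) = 1].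

Definition translation_surface (R : realType) (M : set 'rV[R]_4) : Prop :=
  regular_surface_in_S3 M /\
  forall p, M p ->
    exists (I J : set R) (alpha beta : R -> 'rV[R]_4),
      [/\ arclength_curve_in_S3 I alpha,
          arclength_curve_in_S3 J beta &
          local_parametrization M p (I `*` J)
            (fun u => qmul (alpha u.1) (beta u.2))].

(* Velocities at p of smooth curves in M through p. *)
Definition tangent_space (R : realType) (M : set 'rV[R]_4) (p : 'rV[R]_4) :
    set 'rV[R]_4 :=
  [set v | exists (e : R) (gamma : R -> 'rV[R]_4),
     [/\ 0 < e, smooth_on `]- e, e[%classic gamma,
         (forall t, t \in `]- e, e[ -> M (gamma t)),
         gamma 0 = p & derive1 gamma 0 = v]].

(* N is a smooth unit normal of M in S^3 over M `&` V, i.e. tangent to S^3 and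
   normal to M; smoothness on M means, as usual, having a smooth local extension
   to the ambient space, and N is such an extension. *)
Definition unit_normal_field (R : realType) (M V : set 'rV[R]_4)
    (N : 'rV[R]_4 -> 'rV[R]_4) : Prop :=
  smooth_on V N /\
  forall q, M q -> V q ->
    [/\ dot (N q) (N q) = 1, dot (N q) q = 0 &
        forall v, tangent_space M q v -> dot (N q) v = 0].

(* II_p(v, w) = < - dN_p(v), w > for v, w tangent to M at p.  As < N(q), q > = 0
   on M, the derivative of N along v is tangent to S^3, hence it is also the
   Levi-Civita derivative of S^3. *)
Definition second_fundamental_form (R : realType) (N : 'rV[R]_4 -> 'rV[R]_4)
    (p v w : 'rV[R]_4) : R :=
  dot (- 'D_v N p) w.

(* The choice of the local unit normal is immaterial: on M it is unique up to
   sign near p, and 'D_v N p depends only on N restricted to M for v tangent. *)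
Definition umbilic_at (R : realType) (M : set 'rV[R]_4) (p : 'rV[R]_4) : Prop :=
  exists (V : set 'rV[R]_4) (N : 'rV[R]_4 -> 'rV[R]_4),
    [/\ open_nbhs p V, unit_normal_field M V N &
        exists lambda : R, forall v w,
          tangent_space M p v -> tangent_space M p w ->
          second_fundamental_form N p v w = lambda * dot v w].

Definition geodesic_at (R : realType) (M : set 'rV[R]_4) (p : 'rV[R]_4) : Prop :=
  exists (V : set 'rV[R]_4) (N : 'rV[R]_4 -> 'rV[R]_4),
    [/\ open_nbhs p V, unit_normal_field M V N &
        forall v w,
          tangent_space M p v -> tangent_space M p w ->
          second_fundamental_form N p v w = 0].

Definition totally_umbilic (R : realType) (M : set 'rV[R]_4) : Prop :=
  forall p, M p -> umbilic_at M p.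

Definition totally_geodesic (R : realType) (M : set 'rV[R]_4) : Prop :=
  forall p, M p -> geodesic_at M p.

(* Main.v *)
(* Write alpha' = alpha a and beta' = b beta with a(s), b(t) unit imaginary
   quaternions, let da, db be their derivatives, and let N = alpha n beta be the
   unit normal.
   Then X_st = alpha (a b) beta, X_ss = alpha (da - 1) beta and
   X_tt = alpha (db - 1) beta, and n is parallel to the cross product a x b.
   With f = <a, b>, umbilicity at X(s,t) eliminates both n and the umbilicity
   factor, and becomes f [da, a, b] = f [db, a, b] = 1 - f^2, where
   [., ., .] is the triple product and 1 - f^2 <> 0 by regularity.
   Differentiating the first equation in t and the second one in s gives
   f_t = f f_s and f_s = f f_t, so that <da, b> = f_s = 0 and hence
   <da, db> = 0.  But da and db are now both parallel to a x b and nonzero.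
   A totally geodesic surface is the umbilic case with factor 0. *)
Require Import Defs.
From HB Require Import structures.
From mathcomp Require Import all_boot all_order all_algebra.
From mathcomp Require Import all_classical all_reals all_analysis.
From mathcomp Require Import ring.

Import Order.TTheory GRing.Theory Num.Theory.
Import numFieldNormedType.Exports.

Local Open Scope classical_set_scope.
Local Open Scope ring_scope.

(** * Quaternion algebra and the Euclidean inner product *)

Lemma quatP {R : realType} (x y : 'rV[R]_4) :
  x 0 0 = y 0 0 -> x 0 1 = y 0 1 -> x 0 2 = y 0 2 -> x 0 3 = y 0 3 -> x = y.
Proof.
move=> h0 h1 h2 h3; apply/rowP => -[[|[|[|[|//]]]] p].
- by have -> : Ordinal p = 0 by exact/val_inj.
- by have -> : Ordinal p = 1 by exact/val_inj.
- by have -> : Ordinal p = 2 by exact/val_inj.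
- by have -> : Ordinal p = 3 by exact/val_inj.
Qed.

Lemma dot4E {R : realType} (x y : 'rV[R]_4) :
  dot x y = x 0 0 * y 0 0 + x 0 1 * y 0 1 + x 0 2 * y 0 2 + x 0 3 * y 0 3.
Proof.
rewrite /dot !big_ord_recl big_ord0 addr0 !addrA.
do ?[congr (_ + _)]; congr (x 0 _ * y 0 _); exact/val_inj.
Qed.

Definition qone {R : realType} : 'rV[R]_4 := \row_(i < 4) [:: 1; 0; 0; 0]`_i.

Definition qconj {R : realType} (x : 'rV[R]_4) : 'rV[R]_4 :=
  \row_(i < 4) [:: x 0 0; - x 0 1; - x 0 2; - x 0 3]`_i.

Lemma qmulA {R : realType} (x y z : 'rV[R]_4) :
  qmul x (qmul y z) = qmul (qmul x y) z.
Proof. by apply: quatP; rewrite !mxE /=; ring. Qed.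

Lemma qmul1q {R : realType} (x : 'rV[R]_4) : qmul qone x = x.
Proof. by apply: quatP; rewrite !mxE /=; ring. Qed.

Lemma qmulq1 {R : realType} (x : 'rV[R]_4) : qmul x qone = x.
Proof. by apply: quatP; rewrite !mxE /=; ring. Qed.

Lemma qmulDl {R : realType} (x y z : 'rV[R]_4) :
  qmul (x + y) z = qmul x z + qmul y z.
Proof. by apply: quatP; rewrite !mxE /=; ring. Qed.

Lemma qmulDr {R : realType} (x y z : 'rV[R]_4) :
  qmul x (y + z) = qmul x y + qmul x z.
Proof. by apply: quatP; rewrite !mxE /=; ring. Qed.

Lemma qmul0q {R : realType} (x : 'rV[R]_4) : qmul 0 x = 0.
Proof. by apply: quatP; rewrite !mxE /=; ring. Qed.

Lemma qmulq0 {R : realType} (x : 'rV[R]_4) : qmul x 0 = 0.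
Proof. by apply: quatP; rewrite !mxE /=; ring. Qed.

Lemma qmulZl {R : realType} (k : R) (x y : 'rV[R]_4) :
  qmul (k *: x) y = k *: qmul x y.
Proof. by apply: quatP; rewrite !mxE /=; ring. Qed.

Lemma qmulZr {R : realType} (k : R) (x y : 'rV[R]_4) :
  qmul x (k *: y) = k *: qmul x y.
Proof. by apply: quatP; rewrite !mxE /=; ring. Qed.

Lemma qmul_conjr {R : realType} (x : 'rV[R]_4) :
  qmul x (qconj x) = dot x x *: qone.
Proof. by apply: quatP; rewrite !dot4E !mxE /=; ring. Qed.

Lemma qmul_conjl {R : realType} (x : 'rV[R]_4) :
  qmul (qconj x) x = dot x x *: qone.
Proof. by apply: quatP; rewrite !dot4E !mxE /=; ring. Qed.

Lemma dot_qmull {R : realType} (x y z : 'rV[R]_4) :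
  dot x (qmul y z) = dot (qmul (qconj y) x) z.
Proof. by rewrite !dot4E !mxE /=; ring. Qed.

Lemma dot_qmulr {R : realType} (x y z : 'rV[R]_4) :
  dot x (qmul y z) = dot (qmul x (qconj z)) y.
Proof. by rewrite !dot4E !mxE /=; ring. Qed.

Lemma dotC {R : realType} {n} (x y : 'rV[R]_n) : dot x y = dot y x.
Proof. by apply: eq_bigr => i _; rewrite mulrC. Qed.

Lemma dotDl {R : realType} {n} (x y z : 'rV[R]_n) :
  dot (x + y) z = dot x z + dot y z.
Proof. by rewrite /dot -big_split; apply: eq_bigr => i _; rewrite mxE mulrDl. Qed.

Lemma dotDr {R : realType} {n} (x y z : 'rV[R]_n) :
  dot x (y + z) = dot x y + dot x z.
Proof. by rewrite dotC dotDl !(dotC x). Qed.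

Lemma dotZl {R : realType} {n} (k : R) (x y : 'rV[R]_n) :
  dot (k *: x) y = k * dot x y.
Proof. by rewrite /dot mulr_sumr; apply: eq_bigr => i _; rewrite mxE mulrA. Qed.

Lemma dotNl {R : realType} {n} (x y : 'rV[R]_n) : dot (- x) y = - dot x y.
Proof. by rewrite -scaleN1r dotZl mulN1r. Qed.

Lemma dot0l {R : realType} {n} (x : 'rV[R]_n) : dot 0 x = 0.
Proof. by rewrite -(scale0r x) dotZl mul0r. Qed.

Lemma dot_eq0 {R : realType} {n} (x : 'rV[R]_n) : dot x x = 0 -> x = 0.
Proof.
move/eqP; rewrite psumr_eq0 => [/allP h|i _]; last by rewrite -expr2 sqr_ge0.
apply/rowP => i; have := h i (mem_index_enum i).
by rewrite mxE mulf_eq0 orbb => /eqP.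
Qed.

Lemma dot_qmul_unitl {R : realType} (x y z : 'rV[R]_4) : dot x x = 1 ->
  dot (qmul x y) (qmul x z) = dot y z.
Proof. by move=> x1; rewrite dot_qmull qmulA qmul_conjl x1 scale1r qmul1q. Qed.

Lemma dot_qmul_unitr {R : realType} (x y z : 'rV[R]_4) : dot x x = 1 ->
  dot (qmul y x) (qmul z x) = dot y z.
Proof. by move=> x1; rewrite dot_qmulr -qmulA qmul_conjr x1 scale1r qmulq1. Qed.

(** * Triple products of imaginary quaternions *)

(** Elimination of the unit normal [n] and the umbilicity factor [l]. An imaginary quaternion sees
    only the part a x b of [qmul a b], and a x b is [n] times <n, ab>. Hence [c, a, b] = l <n, ab>,
    and multiplying by <a, b> gives <n, ab>^2. It serves for [c] = da and for [c] = db. *)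
Lemma triple_normal {R : realType} (n a b c : 'rV[R]_4) (l : R) :
  n 0 0 = 0 -> a 0 0 = 0 -> b 0 0 = 0 -> c 0 0 = 0 ->
  dot n n = 1 -> dot a a = 1 -> dot b b = 1 -> dot n a = 0 -> dot n b = 0 ->
  dot n (qmul a b) = l * dot a b -> dot n c = l ->
  dot a b * dot c (qmul a b) = 1 - dot a b ^+ 2.
Proof.
move=> n0 a0 b0 c0 nn aa bb na nb nab nc.
(* the Lagrange identity, since [n] is parallel to [a x b] *)
have gram : 1 - dot a b ^+ 2 = dot n (qmul a b) ^+ 2.
  apply/eqP; rewrite -subr_eq0; apply/eqP.
  transitivity (dot n n * (dot a a * dot b b - dot a b ^+ 2)
    - dot n (qmul a b) ^+ 2); first by rewrite nn aa bb; ring.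
  transitivity (dot a a * dot n b ^+ 2 + dot b b * dot n a ^+ 2
    - 2 * dot a b * dot n a * dot n b).
    by rewrite !dot4E !mxE /= n0 a0 b0; ring.
  by rewrite na nb; ring.
(* Cramer's rule for [n] in terms of [c], [a], [b], paired with [n]; the terms in <n, a> and <n, b>
   vanish. *)
have cab : dot c (qmul a b) = dot n (qmul a b) * dot n c.
  rewrite -[LHS]mulr1 -nn; apply/eqP; rewrite -subr_eq0; apply/eqP.
  transitivity (dot n a * dot c (qmul n b) - dot n b * dot c (qmul n a)).
    by rewrite !dot4E !mxE /= n0 a0 b0 c0; ring.
  by rewrite na nb; ring.
by rewrite gram cab nc nab; ring.
Qed.

(* The product of the determinants [c, a, d] and [a, b, a x b] as a Gram
   determinant. *)
Lemma triple_gram {R : realType} (a b c d : 'rV[R]_4) :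
  a 0 0 = 0 -> b 0 0 = 0 -> c 0 0 = 0 -> d 0 0 = 0 ->
  dot a a = 1 -> dot b b = 1 -> dot c a = 0 -> dot d b = 0 ->
  dot c (qmul a d) * (1 - dot a b ^+ 2) =
  - (dot c b * dot d (qmul a b)) - dot c (qmul a b) * dot a b * dot d a.
Proof.
move=> a0 b0 c0 d0 aa bb ca db.
transitivity (dot c (qmul a d) * (dot a a * dot b b - dot a b ^+ 2)).
  by rewrite aa bb mulr1.
transitivity (dot c a * (dot a b * dot d (qmul a b))
  - dot c b * (dot a a * dot d (qmul a b))
  + dot c (qmul a b) * (dot a a * dot d b - dot a b * dot d a)).
  by rewrite !dot4E !mxE /= a0 b0 c0 d0; ring.
by rewrite ca aa db; ring.
Qed.

(** * Derivatives of rows, inner products and quaternion products *)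

Lemma is_derive_mx {R : realType} {V : normedModType R} {m n : nat}
    (M : V -> 'M[R]_(m, n)) (dM : 'M[R]_(m, n)) (t v : V) :
  (forall i j, is_derive t v (fun x => M x i j) (dM i j)) <-> is_derive t v M dM.
Proof.
split=> [h|[Mt Me] i j].
  have Mt : derivable M t v by apply/derivable_mxP => i j; have [] := h i j.
  apply: DeriveDef => //; rewrite derive_mx//; apply/matrixP => i j.
  by rewrite mxE; have [] := h i j.
have/derivable_mxP Mij := Mt.
by apply: DeriveDef => //; rewrite -Me derive_mx// mxE.
Qed.

Lemma is_derive_row4 {R : realType} {V : normedModType R}
    (M : V -> 'rV[R]_4) (dM : 'rV[R]_4) (t v : V) :
  is_derive t v (fun x => M x 0 0) (dM 0 0) ->
  is_derive t v (fun x => M x 0 1) (dM 0 1) ->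
  is_derive t v (fun x => M x 0 2) (dM 0 2) ->
  is_derive t v (fun x => M x 0 3) (dM 0 3) -> is_derive t v M dM.
Proof.
move=> h0 h1 h2 h3; apply/is_derive_mx => i; rewrite (ord1 i).
case=> -[|[|[|[|//]]]] p.
- by have -> : Ordinal p = 0 by exact/val_inj.
- by have -> : Ordinal p = 1 by exact/val_inj.
- by have -> : Ordinal p = 2 by exact/val_inj.
- by have -> : Ordinal p = 3 by exact/val_inj.
Qed.

Lemma is_derive_dot {R : realType} {V : normedModType R}
    {n} {F G : V -> 'rV[R]_n} {t v : V} {dF dG : 'rV[R]_n} :
  is_derive t v F dF -> is_derive t v G dG ->
  is_derive t v (fun x => dot (F x) (G x)) (dot dF (G t) + dot (F t) dG).
Proof.
move=> /is_derive_mx dF1 /is_derive_mx dG1.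
have -> : (fun x => dot (F x) (G x)) = \sum_(i < n) (fun x => F x 0 i * G x 0 i).
  by apply/funext => x; rewrite fct_sumE.
apply: is_derive_eq (is_derive_sum (fun i => is_deriveM (dF1 0 i) (dG1 0 i))) _.
rewrite /dot -[RHS]big_split; apply: eq_bigr => i _ /=.
by rewrite addrC; congr (_ + _); exact: mulrC.
Qed.

Lemma is_derive_qmul {R : realType} {V : normedModType R}
    {F G : V -> 'rV[R]_4} {t v : V} {dF dG : 'rV[R]_4} :
  is_derive t v F dF -> is_derive t v G dG ->
  is_derive t v (fun x => qmul (F x) (G x)) (qmul dF (G t) + qmul (F t) dG).
Proof.
move=> /is_derive_mx/(_ 0) F' /is_derive_mx/(_ 0) G'.
(* Each coordinate of the product is a signed sum of four such terms. *)
have M i j : is_derive t v (fun x => F x 0 i * G x 0 j)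
    (F t 0 i * dG 0 j + dF 0 i * G t 0 j).
  apply: is_derive_eq (is_deriveM (F' i) (G' j)) _.
  by rewrite /GRing.scale/= (mulrC (dF 0 i)).
apply: is_derive_row4.
- under eq_fun do rewrite mxE /=.
  apply: is_derive_eq (is_deriveB (is_deriveB (is_deriveB (M 0 0) (M 1 1))
    (M 2 2)) (M 3 3)) _.
  by rewrite !mxE /=; ring.
- under eq_fun do rewrite mxE /=.
  apply: is_derive_eq (is_deriveB (is_deriveD (is_deriveD (M 0 1) (M 1 0))
    (M 2 3)) (M 3 2)) _.
  by rewrite !mxE /=; ring.
- under eq_fun do rewrite mxE /=.
  apply: is_derive_eq (is_deriveD (is_deriveD (is_deriveB (M 0 2) (M 1 3))
    (M 2 0)) (M 3 1)) _.
  by rewrite !mxE /=; ring.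
- under eq_fun do rewrite mxE /=.
  apply: is_derive_eq (is_deriveD (is_deriveB (is_deriveD (M 0 3) (M 1 2))
    (M 2 1)) (M 3 0)) _.
  by rewrite !mxE /=; ring.
Qed.

Lemma is_derive_dotr {R : realType} {V : normedModType R} {n}
    (c : 'rV[R]_n) {G : V -> 'rV[R]_n} {t v : V} {dG : 'rV[R]_n} :
  is_derive t v G dG -> is_derive t v (fun x => dot c (G x)) (dot c dG).
Proof.
move=> /(is_derive_dot (is_derive_cst c t v)) /is_derive_eq; apply.
by rewrite dot0l add0r.
Qed.

Lemma is_derive_qmull {R : realType} {V : normedModType R}
    (c : 'rV[R]_4) {F : V -> 'rV[R]_4} {t v : V} {dF : 'rV[R]_4} :
  is_derive t v F dF -> is_derive t v (fun x => qmul (F x) c) (qmul dF c).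
Proof.
move=> /is_derive_qmul /(_ (is_derive_cst c t v)) /is_derive_eq; apply.
by rewrite qmulq0 addr0.
Qed.

Lemma is_derive_qmulr {R : realType} {V : normedModType R}
    (c : 'rV[R]_4) {G : V -> 'rV[R]_4} {t v : V} {dG : 'rV[R]_4} :
  is_derive t v G dG -> is_derive t v (fun x => qmul c (G x)) (qmul c dG).
Proof.
move=> /(is_derive_qmul (is_derive_cst c t v)) /is_derive_eq; apply.
by rewrite qmul0q add0r.
Qed.

(** The tool for differentiating an identity that is known only on an open set. *)
Lemma is_derive_unique_on {R : realType} {V W : normedModType R} {U : set V}
    {f g : V -> W} {t v : V} {df dg : W} :
  open U -> U t -> (forall x, U x -> f x = g x) ->
  is_derive t v f df -> is_derive t v g dg -> df = dg.
Proof.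
move=> oU Ut fg f' g'.
have [_ <-] : is_derive t v g df.
  by apply: near_eq_is_derive f'; near=> x; apply: fg; near: x; exact: open_nbhs_nbhs.
by have [_ <-] := g'.
Unshelve. all: by end_near. Qed.

(** * The umbilicity equations of two frames and their incompatibility *)

Lemma triple_swap {R : realType} (a b c : 'rV[R]_4) :
  a 0 0 = 0 -> b 0 0 = 0 -> c 0 0 = 0 ->
  dot c (qmul b a) = - dot c (qmul a b).
Proof. by move=> a0 b0 c0; rewrite !dot4E !mxE /= a0 b0 c0; ring. Qed.

(** With [c] = da this is f_t = f f_s. The sign [e] allows a second use with the two frames
    exchanged, which reverses the triple products. *)
Lemma derive_umbilic_eq {R : realType} (J : set R) (a c db : 'rV[R]_4)
    (b : R -> 'rV[R]_4) (t e : R) (f := fun x => dot a (b x)) :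
  open J -> J t -> is_derive t 1 b db ->
  a 0 0 = 0 -> b t 0 0 = 0 -> c 0 0 = 0 -> db 0 0 = 0 ->
  dot a a = 1 -> dot (b t) (b t) = 1 -> dot c a = 0 -> dot db (b t) = 0 ->
  e != 0 -> 1 - f t ^+ 2 != 0 ->
  (forall x, J x -> f x * dot c (qmul a (b x)) = e * (1 - f x ^+ 2)) ->
  f t * dot db (qmul a (b t)) = e * (1 - f t ^+ 2) ->
  dot a db = f t * dot c (b t).
Proof.
move=> oJ Jt b' a0 b0 c0 db0 aa bb ca dbb e0 D0 fc fdb.
have f' : is_derive t 1 f (dot a db) := is_derive_dotr a b'.
have T' := is_derive_dotr c (is_derive_qmulr a b').
have /(is_derive_unique_on oJ Jt fc (is_deriveM f' T')) :=
  is_deriveM (is_derive_cst e t 1)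
    (is_deriveB (is_derive_cst (1 : R) t 1) (is_deriveX 2 f')).
rewrite /GRing.scale /= => E.
have G := triple_gram _ _ _ _ a0 b0 c0 db0 aa bb ca dbb.
have := fc t Jt.
move: E G fdb D0; rewrite -/(f t) (dotC db a).
(* Only polynomial algebra remains: T = [c, a, db], p = [c, a, b], q = [db, a, b], with [E] the
   differentiated equation and [G] the Gram identity. *)
move: (f t) (dot a db) (dot c (b t)) (dot c (qmul a db)) (dot c (qmul a (b t)))
  (dot db (qmul a (b t))) => F ft fs T p q E G fdb D0 fc0.
(* Multiplied by F, the right side of [G] contains F q and F p, both equal to e (1 - F^2); this
   nonzero factor then cancels. *)
have : F * T = - (e * fs) - e * F * ft.
  apply: (mulIf D0).
  have -> : F * T * (1 - F ^+ 2) = F * (T * (1 - F ^+ 2)) by ring.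
  rewrite G.
  have -> : F * (- (fs * q) - p * F * ft) = - (F * q) * fs - (F * p) * F * ft by ring.
  by rewrite fdb fc0; ring.
rewrite mulr0 addr0 in E => FT.
have pE : p * ft = e * fs - e * F * ft.
  apply: (addrI (F * T)); rewrite E FT; ring.
apply: (mulfI e0).
(* The split makes e (1 - F^2) = F p appear, so that the value of p ft applies. *)
transitivity (e * (1 - F ^+ 2) * ft + e * F ^+ 2 * ft); first by ring.
have -> : e * (1 - F ^+ 2) * ft = F * (p * ft) by rewrite -fc0; ring.
by rewrite pE; ring.
Qed.

(** The product of the determinants [u, a, b] and [v, a, b] is a 3 x 3 Gram determinant, expanded
    here. *)
Lemma triple_mul {R : realType} (u v a b : 'rV[R]_4) :
  u 0 0 = 0 -> v 0 0 = 0 -> a 0 0 = 0 -> b 0 0 = 0 ->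
  dot u (qmul a b) * dot v (qmul a b) =
  dot u v * (dot a a * dot b b - dot a b ^+ 2)
  - dot u b * dot v b * dot a a + dot u b * dot v a * dot a b
  + dot u a * dot v b * dot a b - dot u a * dot v a * dot b b.
Proof. by move=> u0 v0 a0 b0; rewrite !dot4E !mxE /= u0 v0 a0 b0; ring. Qed.

Lemma no_umbilic_frames {R : realType} (I J : set R) (a da b db : R -> 'rV[R]_4)
    (s t : R) :
  open I -> open J -> I s -> J t ->
  (forall s, I s -> [/\ is_derive s 1 a (da s), a s 0 0 = 0, da s 0 0 = 0,
                       dot (a s) (a s) = 1 & dot (da s) (a s) = 0]) ->
  (forall t, J t -> [/\ is_derive t 1 b (db t), b t 0 0 = 0, db t 0 0 = 0,
                       dot (b t) (b t) = 1 & dot (db t) (b t) = 0]) ->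
  (forall s t, I s -> J t -> let f := dot (a s) (b t) in
     [/\ 1 - f ^+ 2 != 0,
         f * dot (da s) (qmul (a s) (b t)) = 1 - f ^+ 2 &
         f * dot (db t) (qmul (a s) (b t)) = 1 - f ^+ 2]) -> False.
Proof.
move=> oI oJ Is Jt ha hb hab.
(* Proved on all of [J], not just at [t], so that it can be differentiated in the second
   parameter. *)
have dab0 x : J x -> dot (da s) (b x) = 0.
  move=> Jx; have [a' a0 da0 aa daa] := ha s Is; have [b' b0 db0 bb dbb] := hb x Jx.
  have [D0 E1 E2] := hab s x Is Jx.
  have F1 : dot (a s) (db x) = dot (a s) (b x) * dot (da s) (b x).
    apply: (derive_umbilic_eq _ _ _ _ _ x 1 oJ) => //; rewrite ?oner_eq0 ?mul1r//.
    by move=> y Jy; rewrite mul1r; have [] := hab s y Is Jy.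
  (* Same lemma with the frames exchanged, hence the sign -1. *)
  have F2 : dot (b x) (da s) = dot (b x) (a s) * dot (db x) (a s).
    apply: (derive_umbilic_eq _ _ _ _ _ s (-1) oI) => //.
    - by rewrite dotC.
    - move=> y Iy; have [_ ay0 day0 _ _] := ha y Iy.
      by rewrite mulN1r triple_swap// (dotC (b x)) mulrN; have [_ _ ->] := hab y x Iy Jx.
    - by rewrite mulN1r triple_swap// (dotC (b x)) mulrN E1.
  (* The two relations combine to f_s = f^2 f_s. *)
  apply: (mulfI D0).
  rewrite mulr0 mulrBl mul1r [X in X - _]dotC F2 (dotC (db x)) F1 (dotC (b x)).
  by ring.
have dab : dot (da s) (db t) = 0.
  have [b' _ _ _ _] := hb t Jt.
  exact: (is_derive_unique_on oJ Jt dab0 (is_derive_dotr (da s) b')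
    (is_derive_cst 0 t 1)).
have [a' a0 da0 aa daa] := ha s Is; have [b' b0 db0 bb dbb] := hb t Jt.
have [D0 E1 E2] := hab s t Is Jt.
(* Every term has a factor <da, db>, <da, b> or <da, a>, so one triple product vanishes, which
   forces 1 - f^2 = 0. *)
have := triple_mul (da s) (db t) (a s) (b t) da0 db0 a0 b0.
rewrite dab dab0// daa dbb !mul0r !(subr0, addr0) => /eqP.
rewrite mulf_eq0 => /orP[] /eqP w0.
  by move: E1 D0; rewrite w0 mulr0 => <-; rewrite eqxx.
by move: E2 D0; rewrite w0 mulr0 => <-; rewrite eqxx.
Qed.

(** * Tangent vectors and the second fundamental form along curves *)

Lemma linear_row_continuous {R : realType} {n} {W : normedModType R}
    (L : {linear 'rV[R]_n -> W}) : continuous L.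
Proof.
move=> x; apply: differentiable_continuous.
have -> : (L : _ -> _) = \sum_(i < n) (fun y : 'rV[R]_n => y 0 i *: L (delta_mx 0 i)).
  apply/funext => y; rewrite fct_sumE [in LHS](row_sum_delta y) linear_sum.
  by apply: eq_bigr => i _; rewrite linearZ.
by apply: differentiable_sum => i; apply: differentiableZl; exact: differentiable_coord.
Qed.

(** Since [U] is open, [f] and [g] agree near each of its points, so their directional derivatives
    agree on [U] and the induction continues. *)
Lemma Ck_ext {R : realType} {W : normedModType R} (k : nat) (U : set R)
    (f g : R -> W) : open U -> (forall x, U x -> f x = g x) -> Ck k U f -> Ck k U g.
Proof.
move=> oU.
have near_eq (p q : R -> W) x : (forall x, U x -> p x = q x) -> U x ->
    \near x, p x = q x.
  by move=> pq Ux; near=> y; apply: pq; near: y; exact: open_nbhs_nbhs.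
elim: k f g => [|k IH] f g fg /=.
  move=> fU x Ux; have := fU x Ux; rewrite /prop_for/= /continuous_at (fg x Ux).
  apply: cvg_trans; apply: near_eq_cvg.
  by have := near_eq _ _ _ fg Ux; apply: filterS => y ->.
move=> [df Df]; split=> [x Ux|v].
  apply/derivable1_diffP/near_eq_derivable; first exact: near_eq fg Ux.
  exact/derivable1_diffP/df.
apply: IH (Df v) => x Ux; exact: near_eq_derive (near_eq _ _ _ fg Ux).
Unshelve. all: by end_near. Qed.

(** Differentiation preserves this form: the derivative along [v] is [L] applied to the shifted
    ['D_v f]. *)
Lemma Ck_linear_shift {R : realType} {V W : normedModType R} {k : nat} (I U : set R)
    (f : R -> V) (L : {linear V -> W}) (c : R) :
  continuous L -> open U -> (forall h, U h -> I (h + c)) ->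
  Ck k I f -> Ck k U (fun h => L (f (h + c))).
Proof.
move=> cL oU UI; elim: k f => [|k IH] f /=.
  move=> cf h Uh; apply: (@continuous_comp _ _ _ (fun h => f (h + c)) L); last exact: cL.
  apply: (@continuous_comp _ _ _ (shift c) f); last by apply: cf; exact: UI.
  exact/differentiable_continuous.
move=> [df Df].
have ds h : U h -> differentiable (f \o shift c) h.
  by move=> Uh; apply: differentiable_comp => //; apply: df; exact: UI.
split=> [h Uh|v].
  exact: (differentiable_comp (ds h Uh) (linear_differentiable _ cL)).
apply: Ck_ext oU _ (IH _ (Df v)) => h Uh.
have dL := linear_differentiable (f (h + c)) cL.
rewrite [RHS]deriveE; last exact: (differentiable_comp (ds h Uh) dL).
rewrite (diff_comp (ds h Uh) dL)/= diff_lin//; congr (L _).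
rewrite diff_comp//=; last by apply: df; exact: UI.
rewrite deriveE; last by apply: df; exact: UI.
congr ('d f _ _).
rewrite -deriveE//; apply/esym; have [_] := is_derive_shift h v c; exact.
Qed.

Lemma is_derive_Ck {R : realType} {V W : normedModType R} {k : nat} {U : set V}
    {f : V -> W} {x v : V} : Ck k.+1 U f -> U x -> is_derive x v f ('D_v f x).
Proof. by move=> [df _] Ux; exact/derivableP/diff_derivable/df. Qed.

(** Supplies X_s and X_t as tangent vectors, [f] being multiplication by a fixed beta(t) or
    alpha(s). The curve is shifted because [tangent_space] takes velocities at time 0. *)
Lemma tangent_image {R : realType} (M : set 'rV[R]_4) (I : set R)
   (a : R -> 'rV[R]_4) (s : R) (f : 'rV[R]_4 -> 'rV[R]_4) :
  linear f ->
  open I -> I s -> smooth_on I a -> (forall x, I x -> M (f (a x))) ->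
  tangent_space M (f (a s)) (f (derive1 a s)).
Proof.
move=> lf oI Is sa Ma.
have [L fL] : exists L : {linear 'rV[R]_4 -> 'rV[R]_4}, f = L :> (_ -> _).
  pose L : {linear 'rV[R]_4 -> 'rV[R]_4} :=
    HB.pack f (GRing.isLinear.Build _ _ _ _ f lf).
  by exists L.
move: Ma; rewrite fL => Ma {f lf fL}.
have /nbhs_ballP[e /= e0 eI] : nbhs s I by exact: open_nbhs_nbhs.
have UI h : `]- e, e[%classic h -> I (h + s).
  rewrite /= in_itv/= => /andP[h1 h2]; apply: eI.
  by rewrite /ball/= opprD addrCA subrr addr0 normrN ltr_norml h1.
exists e, (fun h => L (a (h + s))).
have cL := linear_row_continuous L.
split=> //.
- by move=> k; apply: Ck_linear_shift cL _ UI (sa k); exact: interval_open.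
- by move=> t tI; apply: Ma; apply: UI.
- by rewrite add0r.
have [da _] := sa 1%N.
have ds : differentiable (a \o shift s) 0.
  by apply: differentiable_comp => //=; apply: da; rewrite add0r.
have dL := linear_differentiable (a (0 + s)) cL.
rewrite derive1E deriveE; last exact: (differentiable_comp ds dL).
rewrite (diff_comp ds dL)/= diff_lin//; congr (L _).
rewrite diff_comp//=; last by apply: da; rewrite add0r.
have <- : 1 = 'd (shift s) (0 : R) 1 :> R.
  by rewrite -deriveE//; apply/esym; have [_] := is_derive_shift (0 : R) 1 s; exact.
by rewrite add0r derive1E deriveE//; exact: da.
Qed.

(** The Weingarten relation: the derivative of <N, W> = 0 along the curve [g], for a tangent field
    [W]. *)
Lemma second_form_curve {R : realType} (M V : set 'rV[R]_4)
    (N : 'rV[R]_4 -> 'rV[R]_4) (U : set R) (g W : R -> 'rV[R]_4) (s : R)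
    (dg dW : 'rV[R]_4) :
  open_nbhs (g s) V -> unit_normal_field M V N -> open U -> U s ->
  is_derive s 1 g dg -> is_derive s 1 W dW -> (forall x, U x -> M (g x)) ->
  (forall x, U x -> tangent_space M (g x) (W x)) ->
  second_fundamental_form N (g s) dg (W s) = dot (N (g s)) dW.
Proof.
move=> [oV Vp] [sN hN] oU Us g' W' MU TU.
have [gd ge] := g'.
have dg0 : differentiable g s by apply/derivable1_diffP.
have [dN _] := sN 1%N.
have dNg := differentiable_comp dg0 (dN _ Vp).
have Ng' : is_derive s 1 (N \o g) ('D_dg N (g s)).
  apply: DeriveDef; first exact/diff_derivable/dNg.
  rewrite (deriveE _ dNg) (diff_comp dg0 (dN _ Vp))/= -(deriveE _ dg0) ge.
  by rewrite deriveE//; exact: dN.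
(* Orthogonality holds only while [g] stays in [V], which continuity ensures near [s]. *)
have E : \near s, dot ((N \o g) s) (W s) = cst 0 s.
  near=> x.
  have Ux : U x by near: x; exact: open_nbhs_nbhs.
  have Vx : V (g x).
    near: x; apply: (differentiable_continuous dg0); exact: open_nbhs_nbhs.
  by have [_ _ ->] := hN (g x) (MU x Ux) Vx; last exact: TU.
have [_ /=] := near_eq_is_derive E (is_derive_dot Ng' W').
rewrite derive_cst => E'.
rewrite /second_fundamental_form dotNl; apply/eqP.
by rewrite eq_sym -subr_eq0 opprK addrC -E'.
Unshelve. all: by end_near. Qed.

(** * Arc-length curves in the sphere and their translated frames *)

Lemma is_derive_qconj {R : realType} {V : normedModType R}
    {F : V -> 'rV[R]_4} {t v : V} {dF : 'rV[R]_4} :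
  is_derive t v F dF -> is_derive t v (fun x => qconj (F x)) (qconj dF).
Proof.
move=> /is_derive_mx/(_ 0) F'.
by apply: is_derive_row4; under eq_fun do rewrite mxE /=;
  rewrite mxE; [exact: F' | exact: is_deriveN | exact: is_deriveN |
  exact: is_deriveN].
Qed.

(** The inner products come from differentiating |alpha|^2 = 1, |alpha'|^2 = 1 and <alpha, alpha'> =
    0. *)
Lemma arclength_derive {R : realType} (I : set R) (alpha : R -> 'rV[R]_4) :
  arclength_curve_in_S3 I alpha -> 
  let alpha' := derive1 alpha in let alpha'' := derive1 alpha' in
  forall s, I s ->
  [/\ is_derive s 1 alpha (alpha' s), is_derive s 1 alpha' (alpha'' s) &
  [/\ dot (alpha s) (alpha' s) = 0,
      dot (alpha' s) (alpha'' s) = 0 & dot (alpha s) (alpha'' s) = -1]].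
Proof.
move=> [oI _ sa hI] a' a''.
have D1 s : I s -> is_derive s 1 alpha (a' s).
  by move=> Is; rewrite /a' derive1E; exact: is_derive_Ck (sa 1%N) Is.
have D2 s : I s -> is_derive s 1 a' (a'' s).
  have -> : a' = 'D_1 alpha by apply/funext => x; rewrite /a' derive1E.
  move=> Is; rewrite /a'' derive1E.
  have h : Ck 1 I ('D_1 alpha) by have [_] := sa 2%N; exact.
  have -> : a' = 'D_1 alpha by apply/funext => x; rewrite /a' derive1E.
  exact: is_derive_Ck h Is.
have E1 s : I s -> dot (alpha s) (a' s) = 0.
  move=> Is; have h := is_derive_dot (D1 s Is) (D1 s Is).
  have := is_derive_unique_on oI Is (fun x Ix => (hI x Ix).1) h
    (is_derive_cst (1 : R) s 1).
  by rewrite dotC => /eqP; rewrite -mulr2n mulrn_eq0/= => /eqP.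
have E2 s : I s -> dot (a' s) (a'' s) = 0.
  move=> Is; have h := is_derive_dot (D2 s Is) (D2 s Is).
  have := is_derive_unique_on oI Is (fun x Ix => (hI x Ix).2) h
    (is_derive_cst (1 : R) s 1).
  by rewrite dotC => /eqP; rewrite -mulr2n mulrn_eq0/= => /eqP.
move=> s Is; split; [exact: D1|exact: D2|split; [exact: E1|exact: E2|]].
have := is_derive_unique_on oI Is E1 (is_derive_dot (D1 s Is) (D2 s Is))
  (is_derive_cst (0 : R) s 1).
by rewrite (hI s Is).2 => /eqP; rewrite addrC addr_eq0 => /eqP.
Qed.

Lemma qconj_unit {R : realType} (x : 'rV[R]_4) : dot (qconj x) (qconj x) = dot x x.
Proof. by rewrite !dot4E !mxE /=; ring. Qed.

Lemma dot_one {R : realType} (x : 'rV[R]_4) : dot x qone = x 0 0.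
Proof. by rewrite dot4E !mxE /=; ring. Qed.

Lemma qmul_conjKr {R : realType} (x y : 'rV[R]_4) :
  dot y y = 1 -> qmul (qmul x (qconj y)) y = x.
Proof. by move=> y1; rewrite -qmulA qmul_conjl y1 scale1r qmulq1. Qed.

Lemma qmul_conjKl {R : realType} (x y : 'rV[R]_4) :
  dot y y = 1 -> qmul y (qmul (qconj y) x) = x.
Proof. by move=> y1; rewrite qmulA qmul_conjr y1 scale1r qmul1q. Qed.

(** Left translation brings the velocity to the identity: a = conj(x) x', imaginary because <x, x'>
    = 0. In its derivative the summand conj(x') x' is 1 by arc length, whence the term [- qone] in
    the formula for x''. *)
Lemma left_frame {R : realType} (I : set R) (x : R -> 'rV[R]_4) :
  arclength_curve_in_S3 I x ->
  exists a da : R -> 'rV[R]_4, forall s, I s ->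
  [/\ is_derive s 1 a (da s), a s 0 0 = 0, da s 0 0 = 0,
      dot (a s) (a s) = 1 & dot (da s) (a s) = 0] /\
  (derive1 x s = qmul (x s) (a s) /\
   derive1 (derive1 x) s = qmul (x s) (da s - qone)).
Proof.
move=> hx; have [_ _ _ hI] := hx; have := arclength_derive _ _ hx.
set x' := derive1 x; set x'' := derive1 x' => /= D.
exists (fun s => qmul (qconj (x s)) (x' s)).
exists (fun s => qmul (qconj (x' s)) (x' s) + qmul (qconj (x s)) (x'' s)) => s Is.
have [D1 D2 [xx' x'x'' xx'']] := D s Is.
have [x1 x'1] := hI s Is; rewrite /sphere3/= in x1.
rewrite -/x' in x'1.
have a0 : qmul (qconj (x s)) (x' s) 0 0 = 0.
  by rewrite -dot_one -dot_qmull qmulq1 dotC.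
split; last first.
  by rewrite qmul_conjKl// qmul_conjl x'1 scale1r (addrC qone) addrK qmul_conjKl.
split=> //.
- exact: is_derive_qmul (is_derive_qconj D1) D2.
- rewrite -dot_one dotDl -!dot_qmull !qmulq1.
  by rewrite x'1 dotC xx'' subrr.
- by rewrite dot_qmul_unitl ?qconj_unit.
- rewrite dotDl qmul_conjl x'1 scale1r dotC dot_one a0 add0r.
  by rewrite dot_qmul_unitl ?qconj_unit// dotC.
Qed.

(** Mirror image of [left_frame]. Translating the second curve on the right puts both frames between
    the factors: X_s = alpha a beta and X_t = alpha b beta. *)
Lemma right_frame {R : realType} (I : set R) (x : R -> 'rV[R]_4) :
  arclength_curve_in_S3 I x ->
  exists b db : R -> 'rV[R]_4, forall s, I s ->
  [/\ is_derive s 1 b (db s), b s 0 0 = 0, db s 0 0 = 0,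
      dot (b s) (b s) = 1 & dot (db s) (b s) = 0] /\
  (derive1 x s = qmul (b s) (x s) /\
   derive1 (derive1 x) s = qmul (db s - qone) (x s)).
Proof.
move=> hx; have [_ _ _ hI] := hx; have := arclength_derive _ _ hx.
set x' := derive1 x; set x'' := derive1 x' => /= D.
exists (fun s => qmul (x' s) (qconj (x s))).
exists (fun s => qmul (x'' s) (qconj (x s)) + qmul (x' s) (qconj (x' s))) => s Is.
have [D1 D2 [xx' x'x'' xx'']] := D s Is.
have [x1 x'1] := hI s Is; rewrite /sphere3/= in x1.
rewrite -/x' in x'1.
have b0 : qmul (x' s) (qconj (x s)) 0 0 = 0.
  by rewrite -dot_one -dot_qmulr qmul1q dotC.
split; last first.
  by rewrite qmul_conjKr// qmul_conjr x'1 scale1r addrK qmul_conjKr.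
split=> //.
- exact: is_derive_qmul D2 (is_derive_qconj D1).
- rewrite -dot_one dotDl -!dot_qmulr !qmul1q.
  by rewrite x'1 dotC xx'' addNr.
- by rewrite dot_qmul_unitr ?qconj_unit.
- rewrite dotDl qmul_conjr x'1 scale1r [X in _ + X]dotC dot_one b0 addr0.
  by rewrite dot_qmul_unitr ?qconj_unit// dotC.
Qed.

(** * Partial derivatives and regularity of the product parametrization *)

Lemma dot_conj {R : realType} (N x y z : 'rV[R]_4) :
  dot (qmul (qconj x) (qmul N (qconj z))) y = dot N (qmul (qmul x y) z).
Proof. by rewrite dot_qmulr dot_qmull. Qed.

Lemma qmul_linearl {R : realType} (c : 'rV[R]_4) : linear (fun x => qmul x c).
Proof. by move=> k x y; rewrite qmulDl qmulZl. Qed.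

Lemma qmul_linearr {R : realType} (c : 'rV[R]_4) : linear (qmul c).
Proof. by move=> k x y; rewrite qmulDr qmulZr. Qed.

Lemma differentiable_fst {R : realType} {V W : normedModType R} (u : V * W) :
  differentiable (@fst V W) u.
Proof. by apply: linear_differentiable => -[a b]; exact: cvg_fst. Qed.

Lemma differentiable_snd {R : realType} {V W : normedModType R} (u : V * W) :
  differentiable (@snd V W) u.
Proof. by apply: linear_differentiable => -[a b]; exact: cvg_snd. Qed.

Lemma is_derive_fst {R : realType} {W : normedModType R} (f : R -> W) (df : W)
    (u v : R * R) :
  is_derive u.1 1 f df -> is_derive u v (fun p => f p.1) (v.1 *: df).
Proof.
move=> [f1 <-].
have df0 : differentiable f u.1 by apply/derivable1_diffP.
have d1 := differentiable_fst u.
have dfh := differentiable_comp d1 df0.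
apply: DeriveDef; first exact/diff_derivable/dfh.
rewrite (deriveE _ dfh) (diff_comp d1 df0)/= diff_lin/=; last first.
  by move=> -[a b]; exact: cvg_fst.
by rewrite -[in LHS](mulr1 v.1) linearZ deriveE.
Qed.

Lemma is_derive_snd {R : realType} {W : normedModType R} (f : R -> W) (df : W)
    (u v : R * R) :
  is_derive u.2 1 f df -> is_derive u v (fun p => f p.2) (v.2 *: df).
Proof.
move=> [f1 <-].
have df0 : differentiable f u.2 by apply/derivable1_diffP.
have d1 := differentiable_snd u.
have dfh := differentiable_comp d1 df0.
apply: DeriveDef; first exact/diff_derivable/dfh.
rewrite (deriveE _ dfh) (diff_comp d1 df0)/= diff_lin/=; last first.
  by move=> -[a b]; exact: cvg_snd.
by rewrite -[in LHS](mulr1 v.2) linearZ deriveE.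
Qed.

(** Otherwise a = <a, b> b, and the direction (1, -<a, b>) lies in the kernel of the differential of
    X. *)
Lemma regular_product {R : realType} (U : set (R * R)) (x y : R -> 'rV[R]_4)
    (u : R * R) (a b : 'rV[R]_4) :
  let X := fun p : R * R => qmul (x p.1) (y p.2) in
  smooth_on U X -> U u -> injective ('d X u) ->
  is_derive u.1 1 x (qmul (x u.1) a) -> is_derive u.2 1 y (qmul b (y u.2)) ->
  dot a a = 1 -> dot b b = 1 -> 1 - dot a b ^+ 2 != 0.
Proof.
move=> X sX Uu injX x' y' a1 b1; apply/eqP => D0.
(* Its squared length is 1 - <a, b>^2. *)
have ab : a - dot a b *: b = 0.
  apply: dot_eq0; rewrite -scaleNr !(dotDl, dotDr, dotZl).
  rewrite !(dotC _ (_ *: _)) !(dotZl, dotDr, dotDl) a1 b1 (dotC b a) -D0; ring.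
have [dX _] := sX 1%N.
have := is_derive_qmul (is_derive_fst _ _ u (1, - dot a b) x')
  (is_derive_snd _ _ u (1, - dot a b) y').
move=> -[_] /=; rewrite deriveE; last exact: dX.
rewrite scale1r qmulZr qmulA -qmulZl -qmulDl -qmulZr -qmulDr scaleNr ab qmulq0 qmul0q.
rewrite -[RHS](linear0 ('d X u)) => /injX [] /eqP.
by rewrite oner_eq0.
Qed.

(** * Nonexistence of umbilic and geodesic translation surfaces *)

Lemma translation_not_umbilic {R : realType} (M : set 'rV[R]_4) :
  M !=set0 -> translation_surface M -> ~ totally_umbilic M.
Proof.
move=> [p Mp] [_ /(_ p Mp) [I [J [x [y [hx hy [_ sX iX]]]]]]].
move=> [V0 [_ [[_ V0p] XM _ _]]] umb.
have [oI _ sx hI] := hx; have [oJ _ sy hJ] := hy.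
have MX s t : I s -> J t -> M (qmul (x s) (y t)).
  move=> Is Jt; suff [] : (M `&` V0) (qmul (x s) (y t)) by [].
  by rewrite -XM; exists (s, t).
(* The point [p] provides parameters at which the contradiction is reached. *)
have [[s0 t0] [/= Is0 Jt0] _] : ((fun u : R * R => qmul (x u.1) (y u.2)) @` (I `*` J)) p.
  by rewrite XM.
have [a [da ha]] := left_frame _ _ hx; have [b [db hb]] := right_frame _ _ hy.
have Dx := arclength_derive _ _ hx; have Dy := arclength_derive _ _ hy.
apply: (no_umbilic_frames I J a da b db s0 t0 oI oJ Is0 Jt0).
- by move=> s /ha[].
- by move=> t /hb[].
have TS s t : I s -> J t ->
    tangent_space M (qmul (x s) (y t)) (qmul (derive1 x s) (y t)).
  move=> Is Jt.
  exact: (tangent_image _ _ _ _ _ (qmul_linearl (y t)) oI Is sx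
    (fun r Ir => MX r t Ir Jt)).
have TT s t : I s -> J t ->
    tangent_space M (qmul (x s) (y t)) (qmul (x s) (derive1 y t)).
  move=> Is Jt.
  exact: (tangent_image _ _ _ _ _ (qmul_linearr (x s)) oJ Jt sy
    (fun r Jr => MX s r Is Jr)).
move=> s t Is Jt /=.
have [[a' a0 da0 aa daa] [xs1 xs2]] := ha s Is.
have [[b' b0 db0 bb dbb] [yt1 yt2]] := hb t Jt.
have [x' x'' _] := Dx s Is; have [y' y'' _] := Dy t Jt.
have [V [N [pV hN [l hl]]]] := umb _ (MX s t Is Jt).
have TSst := TS s t Is Jt; have TTst := TT s t Is Jt.
(* The three values of the form become <N, X_ss>, <N, X_st> and <N, X_tt>. *)
have IIss := second_form_curve _ _ _ _ _ _ _ _ _ pV hN oI Is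
  (is_derive_qmull (y t) x') (is_derive_qmull (y t) x'')
  (fun r Ir => MX r t Ir Jt) (fun r Ir => TS r t Ir Jt).
have IIst := second_form_curve _ _ _ _ _ _ _ _ _ pV hN oI Is
  (is_derive_qmull (y t) x') (is_derive_qmull (derive1 y t) x')
  (fun r Ir => MX r t Ir Jt) (fun r Ir => TT r t Ir Jt).
have IItt := second_form_curve _ _ _ _ _ _ _ _ _ pV hN oJ Jt
  (is_derive_qmulr (x s) y') (is_derive_qmulr (x s) y'')
  (fun r Jr => MX s r Is Jr) (fun r Jr => TT s r Is Jr).
rewrite !hl// in IIss IIst IItt.
have [_ /(_ _ (MX s t Is Jt) pV.2) [NN NX NT]] := hN.
have NS := NT _ TSst; have {}NT := NT _ TTst.
move: NN NX NS NT IIss IIst IItt x' y' {hl hN pV TSst TTst}.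
move: (N _) => {}N.
rewrite xs1 xs2 yt1 yt2 !qmulA.
have [xs _] := hI s Is; have [yt _] := hJ t Jt; rewrite /sphere3/= in xs yt.
(* Writing the position as alpha 1 beta turns <N, X> = 0 into the vanishing of the real part of the
   pulled-back normal [n]. *)
rewrite -{1}(qmulq1 (x s)) !(dot_qmul_unitl _ _ _ xs, dot_qmul_unitr _ _ _ yt) -!qmulA.
rewrite (qmulA (a s)).
pose n := qmul (qconj (x s)) (qmul N (qconj (y t))).
have nE z : dot N (qmul (x s) (qmul z (y t))) = dot n z by rewrite dot_conj qmulA.
rewrite !nE dot_one aa bb !mulr1 => NN n0 na nb nda nab ndb x' y'.
have nn : dot n n = 1 by rewrite dot_qmul_unitl ?dot_qmul_unitr ?qconj_unit.
(* The -1 in da - 1 and db - 1 is the sphere's own curvature term, orthogonal to the imaginary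
   [n]. *)
have nsub1 z : dot n (z - qone) = dot n z.
  by rewrite dotDr (dotC n (- qone)) dotNl (dotC qone) dot_one n0 subr0.
rewrite !nsub1 in nda ndb.
split.
- exact: (regular_product _ _ _ (s, t) _ _ sX (conj Is Jt)
    (iX (s, t) (conj Is Jt)) x' y' aa bb).
- exact: (triple_normal n _ _ _ l).
- exact: (triple_normal n _ _ _ l).
Qed.

Lemma totally_geodesic_umbilic {R : realType} (M : set 'rV[R]_4) :
  totally_geodesic M -> totally_umbilic M.
Proof.
move=> geo p /geo [V [N [pV hN II0]]]; exists V, N; split=> //.
by exists 0 => v w Tv Tw; rewrite mul0r II0.
Qed.

Theorem theorem3p1 (R : realType) :
  (~ exists M : set 'rV[R]_4,
       [/\ M !=set0, translation_surface M & totally_umbilic M]) /\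
  (~ exists M : set 'rV[R]_4,
       [/\ M !=set0, translation_surface M & totally_geodesic M]).
Proof.
split=> -[M [M0 MT]]; first exact: translation_not_umbilic.
by move/totally_geodesic_umbilic; exact: translation_not_umbilic.
Qed.
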